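(* Let $\Omega$ be an $S$-partitionable poset. The $\mathbf{cd}$-index $\Phi(\Omega)$ can be recursively computed in terms of the $S$-partitionable parts of $\Omega$ of smaller rank, and is consequently non-negative, i.e. all coefficients of $\Phi(\Omega)$, as a polynomial in the non-commuting variables $\mathbf c,\mathbf d$, are non-negative.
   Context: **Posets.** All posets are finite and graded, with a minimum $\hat 0$ of rank $0$ and a maximum $\hat 1$; $r$ is the rank function, ''rank $d+1$'' means $r(\hat 1)=d+1$, and coatoms are the elements of rank $d$. A lower set of elements (for instance $\Gamma_\sigma$, $\partial\Gamma_\sigma$, $\partial\overline\sigma$ below) is regarded as such a poset by adjoining a maximum $\hat 1$; in particular $\{\emptyset\}$ denotes the rank-one poset $\{\hat0<\hat1\}$. For an element $p$, $\overline p=[\hat 0,p]$; for a set $\mathcal C$ of elements, $\overline{\mathcal C}=\bigcup_{p\in\mathcal C}\overline p$ is its closure; and $\partial\overline\sigma=\overline\sigma\setminus\{\sigma\}$. A poset is Eulerian if every interval $[x,y]$ with $x<y$ has as many elements of even rank as of odd rank. It is near-Eulerian if it can be obtained from an Eulerian poset by deleting a single coatom. For a near-Eulerian poset $\Gamma$, its boundary $\partial\Gamma$ is the closure of the set of all $y$ such that $[y,\hat1]$ is a three-element chain, and its semisuspension $\tilde\Sigma\Gamma$ is the Eulerian poset obtained from $\Gamma$ by adjoining a new coatom $\tau$ that covers every $y$ such that $[y,\hat 1]$ is a three-element chain. **$S$-partitionable posets** (recursive definition). An Eulerian poset $\Omega$ of rank $d+1$ is $S$-partitionable if either $\Omega=\{\emptyset\}$,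 or $\Omega$ has rank at least $2$ and there is a partition of $\Omega\setminus\{\hat 1\}$ with one class $P_\sigma\subseteq\overline\sigma$ for each coatom $\sigma$ (an $S$-partition) such that, writing $\Gamma_\sigma=\overline{P_\sigma\setminus\{\sigma\}}$: (a) there is a unique initial coatom $\sigma_1$ for which $P_{\sigma_1}=\overline{\sigma_1}$, and $P_{\sigma_1}\setminus\{\sigma_1\}=\partial\overline{\sigma_1}$ is $S$-partitionable of rank $d$; (b) there is a unique terminal coatom $\sigma_t$ for which $P_{\sigma_t}=\{\sigma_t\}$; (c) for every other coatom $\sigma$ (called ordinary), $\Gamma_\sigma$ is near-Eulerian of rank $d$ with $\Gamma_\sigma=(P_\sigma\setminus\{\sigma\})\uplus\partial\Gamma_\sigma$ (disjoint union), and $\tilde\Sigma\Gamma_\sigma$ is $S$-partitionable of rank $d$ such that the initial coatom is the added coatom $\tau_\sigma$. The $S$-partitionable parts of smaller rank are the posets arising from an $S$-partition: $\partial\overline{\sigma_1}$ (rank $d$) and, for each ordinary coatom $\sigma$, $\tilde\Sigma\Gamma_\sigma$ (rank $d$) and $\partial\Gamma_\sigma$ (rank $d-1$; it is $S$-partitionable by (a) applied to $\tilde\Sigma\Gamma_\sigma$). **$\mathbf{cd}$-index.** For a poset of rank $d+1$ and $K\subseteq[d]$, $f_K$ is the number of chains whose set of ranks is $K$, and $h_K=\sum_{T\subseteq K}(-1)^{|K\setminus T|}f_T$. Let $\mathbf a,\mathbf b$ be non-commuting variables and $u_K=u_1\cdots u_d$ with $u_i=\mathbf b$ if $i\in K$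 and $u_i=\mathbf a$ if $i\notin K$. The $\mathbf{cd}$-index $\Phi(\Omega)$ is the unique polynomial in non-commuting variables $\mathbf c,\mathbf d$ such that substituting $\mathbf c=\mathbf a+\mathbf b$, $\mathbf d=\mathbf{ab}+\mathbf{ba}$ gives $\sum_{K\subseteq[d]}h_K(\Omega)u_K$. It exists for every Eulerian poset (Bayer–Klapper). *)

(* Defs.v *)
From HB Require Import structures.
From mathcomp Require Import all_boot all_order all_algebra.
From mathcomp.multinomials Require Import monalg.
From Stdlib Require Import ClassicalEpsilon.

Set Implicit Arguments.
Unset Strict Implicit.
Unset Printing Implicit Defensive.

Import Order.TTheory GRing.Theory Num.Theory.

(* A "poset" is a finite partial order with a maximum, a
   [finTPOrderType]; having a minimum and being graded is the predicate
   [graded]. *)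

Local Open Scope order_scope.

Section Posets.
Context {disp : Order.disp_t}.
Implicit Types Omega Gamma : finTPOrderType disp.

Definition is_chain Omega (C : {set Omega}) : bool :=
  [forall x in C, forall y in C, x >=< y].

(* The largest length of a chain ending at x; in a graded poset this is the
   rank function. *)
Definition rank Omega (x : Omega) : nat :=
  \max_(C : {set Omega} | is_chain C && [forall y in C, y < x]) #|C|.

Definition poset_rank Omega : nat := rank (\top : Omega).

Definition covers Omega (y x : Omega) : bool :=
  (x < y) && [forall z, ~~ (x < z < y)].

Definition graded Omega : Prop :=
  (exists z : Omega, forall x, z <= x) /\
  (forall x y : Omega, covers y x -> rank y = (rank x).+1).

Definition coatoms Omega : {set Omega} :=
  [set s | (rank s).+1 == poset_rank Omega].

Definition eulerian Omega : Prop :=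
  graded Omega /\
  forall x y : Omega, x < y ->
    #|[set z | x <= z <= y & ~~ odd (rank z)]| =
    #|[set z | x <= z <= y & odd (rank z)]|.

Definition lower_closure Omega (C : {set Omega}) : {set Omega} :=
  [set x | [exists p in C, x <= p]].

(* f is an isomorphism from Gamma onto E minus the coatom t. *)
Definition near_eulerian Gamma : Prop :=
  exists (E : finTPOrderType disp) (t : E) (f : Gamma -> E),
    [/\ eulerian E, t \in coatoms E,
        forall x y, (f x <= f y) = (x <= y)
      & forall e, (e \in codom f) = (e != t)].

Definition three_chain_below_top Gamma (y : Gamma) : bool :=
  let I := [set z | y <= z] in (#|I| == 3) && is_chain I.

Definition boundary Gamma : {set Gamma} :=
  lower_closure [set y | three_chain_below_top y].

End Posets.

(* The elements of L with a new maximum [None] adjoined. *)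
Definition lower_poset {disp : Order.disp_t} {Omega : finTPOrderType disp}
  (L : {set Omega}) : Type := option {x : Omega | x \in L}.

(* Gamma together with a new coatom [None]. *)
Definition semisuspension {disp : Order.disp_t} (Gamma : finTPOrderType disp)
  : Type := option Gamma.

Section LowerPoset.
Context {disp : Order.disp_t} {Omega : finTPOrderType disp} (L : {set Omega}).

HB.instance Definition _ := Finite.on (lower_poset L).

Definition lower_poset_le (u v : lower_poset L) : bool :=
  match u, v with
  | _, None => true
  | None, Some _ => false
  | Some x, Some y => val x <= val y
  end.

Lemma lower_poset_le_refl : reflexive lower_poset_le.
Proof. by case=> [x|] //=. Qed.

Lemma lower_poset_le_anti : antisymmetric lower_poset_le.
Proof.
case=> [x|] [y|] //= h; congr Some; apply: val_inj; exact: le_anti.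
Qed.

Lemma lower_poset_le_trans : transitive lower_poset_le.
Proof. by case=> [y|] [x|] [z|] //=; apply: le_trans. Qed.

HB.instance Definition _ := Order.Le_isPOrder.Build disp (lower_poset L)
  lower_poset_le_refl lower_poset_le_anti lower_poset_le_trans.

Lemma lower_poset_le_top (u : lower_poset L) : u <= (None : lower_poset L).
Proof. by case: u. Qed.

HB.instance Definition _ :=
  Order.hasTop.Build disp (lower_poset L) lower_poset_le_top.

(* A set of elements of [lower_poset L], seen in Omega. *)
Definition lower_poset_image (B : {set lower_poset L}) : {set Omega} :=
  [set val x | x in [set x : {x : Omega | x \in L} | Some x \in B]].

End LowerPoset.

Section Semisuspension.
Context {disp : Order.disp_t} (Gamma : finTPOrderType disp).

HB.instance Definition _ := Finite.on (semisuspension Gamma).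

(* The new coatom covers the y such that [y, 1] is a three-element chain, so
   what lies strictly below it is their closure, the boundary of Gamma. *)
Definition semisuspension_le (u v : semisuspension Gamma) : bool :=
  match u, v with
  | Some x, Some y => x <= y
  | Some x, None => x \in boundary Gamma
  | None, Some y => y == \top
  | None, None => true
  end.

Lemma boundary_down (x y : Gamma) :
  x <= y -> y \in boundary Gamma -> x \in boundary Gamma.
Proof.
move=> xy; rewrite !inE => /existsP[p /andP[hp yp]].
by apply/existsP; exists p; rewrite hp (le_trans xy yp).
Qed.

Lemma top_notin_boundary : \top \notin boundary Gamma.
Proof.
apply/negP; rewrite inE => /existsP[p /andP[]]; rewrite inE le1x.
case/andP=> /eqP h _ /eqP ptop; move: h; rewrite ptop.
have -> : [set z : Gamma | \top <= z] = [set \top].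
  by apply/setP => z; rewrite !inE le1x.
by rewrite cards1.
Qed.

Lemma semisuspension_le_refl : reflexive semisuspension_le.
Proof. by case=> [x|] //=. Qed.

Lemma semisuspension_le_anti : antisymmetric semisuspension_le.
Proof.
case=> [x|] [y|] //=.
- by move=> h; congr Some; exact: le_anti.
- by case/andP=> h /eqP e; move: h; rewrite e (negbTE top_notin_boundary).
- by case/andP=> /eqP e h; move: h; rewrite e (negbTE top_notin_boundary).
Qed.

Lemma semisuspension_le_trans : transitive semisuspension_le.
Proof.
case=> [y|] [x|] [z|] //=.
- exact: le_trans.
- exact: boundary_down.
- by move=> /eqP ->; rewrite le1x.
- by move=> _ /eqP ->; rewrite lex1.
Qed.

HB.instance Definition _ := Order.Le_isPOrder.Build disp (semisuspension Gamma)
  semisuspension_le_refl semisuspension_le_anti semisuspension_le_trans.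

Lemma semisuspension_le_top (u : semisuspension Gamma) :
  u <= (Some \top : semisuspension Gamma).
Proof. by case: u => [x|] /=; [exact: lex1 | exact: eqxx]. Qed.

HB.instance Definition _ :=
  Order.hasTop.Build disp (semisuspension Gamma) semisuspension_le_top.

Definition added_coatom : semisuspension Gamma := None.

End Semisuspension.

Section SPartitionable.
Context {disp : Order.disp_t}.
Implicit Types Omega Gamma : finTPOrderType disp.

Definition boundary_poset Gamma : finTPOrderType disp :=
  lower_poset (boundary Gamma).

Definition coatom_boundary Omega (s : Omega) : finTPOrderType disp :=
  lower_poset (lower_closure [set s] :\ s).

Definition Gamma_set Omega (P : Omega -> {set Omega}) (s : Omega)
  : {set Omega} := lower_closure (P s :\ s).

Definition Gamma_poset Omega (P : Omega -> {set Omega}) (s : Omega)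
  : finTPOrderType disp := lower_poset (Gamma_set P s).

Definition Gamma_suspension Omega (P : Omega -> {set Omega}) (s : Omega)
  : finTPOrderType disp := semisuspension (Gamma_poset P s).

Definition Gamma_boundary Omega (P : Omega -> {set Omega}) (s : Omega)
  : finTPOrderType disp := boundary_poset (Gamma_poset P s).

Definition ordinary Omega (s1 st : Omega) : {set Omega} :=
  coatoms Omega :\: [set s1; st].

(* P s is the class of the coatom s; the values of P elsewhere are irrelevant *)
Definition coatom_partition Omega (P : Omega -> {set Omega}) : Prop :=
  [/\ {in coatoms Omega &, injective P},
      partition [set P s | s in coatoms Omega] [set~ \top]
    & {in coatoms Omega, forall s, P s \subset lower_closure [set s]}].

(* [S_partition Omega P s1 st]: P is an S-partition of Omega with initial
   coatom s1 and terminal coatom st. *)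
Inductive S_partitionable (Omega : finTPOrderType disp) : Prop :=
| S_partitionable_trivial of
    eulerian Omega & poset_rank Omega = 1%N
| S_partitionable_partition (P : Omega -> {set Omega}) (s1 st : Omega) of
    S_partition P s1 st
with S_partition (Omega : finTPOrderType disp) :
    (Omega -> {set Omega}) -> Omega -> Omega -> Prop :=
| S_partition_intro (P : Omega -> {set Omega}) (s1 st : Omega) of
    eulerian Omega &
    (2 <= poset_rank Omega)%N &
    coatom_partition P &
    unique (fun s => s \in coatoms Omega /\ P s = lower_closure [set s]) s1 &
    S_partitionable (coatom_boundary s1) &
    (poset_rank (coatom_boundary s1)).+1 = poset_rank Omega &
    unique (fun s => s \in coatoms Omega /\ P s = [set s]) st &
    (forall s, s \in ordinary s1 st ->
       [/\ near_eulerian (Gamma_poset P s),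
           (poset_rank (Gamma_poset P s)).+1 = poset_rank Omega,
           Gamma_set P s =
             (P s :\ s) :|: lower_poset_image (boundary (Gamma_poset P s))
         & [disjoint P s :\ s
              & lower_poset_image (boundary (Gamma_poset P s))]]) &
    (forall s, s \in ordinary s1 st ->
       (poset_rank (Gamma_suspension P s)).+1 = poset_rank Omega /\
       exists (Q : Gamma_suspension P s -> {set Gamma_suspension P s})
         (t : Gamma_suspension P s),
         S_partition Q (added_coatom (Gamma_poset P s)) t) :
    S_partition P s1 st.

End SPartitionable.

Local Open Scope ring_scope.

(* Polynomials over the integers in two non-commuting variables; used both for
   (a, b) and for (c, d). The first variable is [false], the second [true]. *)
Notation ncpoly := {malg int[{fmonom bool}]}.

Definition ncvar (i : bool) : ncpoly := << fmu i >>.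

Definition var_a : ncpoly := ncvar false.
Definition var_b : ncpoly := ncvar true.
Definition var_c : ncpoly := ncvar false.
Definition var_d : ncpoly := ncvar true.

Definition cd_subst (F : ncpoly) : ncpoly :=
  mmap (fun n : int => n%:~R)
       (fun w : {fmonom bool} =>
          \prod_(i <- (w : seq bool))
             (if i then var_a * var_b + var_b * var_a else var_a + var_b)) F.

Section CdIndex.
Context {disp : Order.disp_t}.
Implicit Types Omega : finTPOrderType disp.

(* For a poset of rank d+1, subsets of [d] = {1, ..., d} are encoded as
   [{set 'I_d}], with i : 'I_d standing for the rank i+1. *)
Definition dimension Omega : nat := (poset_rank Omega).-1.

(* On a chain the rank is injective, so comparing multisets compares the set
   of ranks; elements of rank 0 or d+1 are thereby excluded. *)
Definition flag_f Omega (K : {set 'I_(dimension Omega)}) : nat :=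
  #|[set C : {set Omega} | is_chain C &
       perm_eq [seq rank x | x in C] [seq (val i).+1 | i in K]]|.

Definition flag_h Omega (K : {set 'I_(dimension Omega)}) : int :=
  \sum_(T : {set 'I_(dimension Omega)} | T \subset K)
     (-1) ^+ #|K :\: T| * (flag_f T)%:Z.

Definition ab_monomial (d : nat) (K : {set 'I_d}) : ncpoly :=
  \prod_(i < d) (if i \in K then var_b else var_a).

Definition ab_index Omega : ncpoly :=
  \sum_(K : {set 'I_(dimension Omega)}) flag_h K *: ab_monomial K.

Definition is_cd_index Omega (Phi : ncpoly) : Prop :=
  cd_subst Phi = ab_index Omega.

(* The polynomial satisfying [is_cd_index Omega], unique when it exists. *)
Definition cd_index Omega : ncpoly :=
  epsilon (inhabits 0) (is_cd_index Omega).

End CdIndex.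

(* Main.v *)
Require Import Defs.
From HB Require Import structures.
From mathcomp Require Import all_boot all_order all_algebra zify.
From mathcomp.multinomials Require Import monalg.
From Stdlib Require Import ClassicalEpsilon.

Set Implicit Arguments.
Unset Strict Implicit.
Unset Printing Implicit Defensive.

Import Order.TTheory GRing.Theory Num.Theory.
Local Open Scope ring_scope.

(** The proof counts chains. Expanding the h-numbers turns the ab-index of a
poset into a sum over the chains between the bottom and the top, where a chain
contributes the word having [b] at the ranks it meets and [a - b] at the other
ranks. For every element [x] of a poset, [flag_sum a b x] is this sum for the
interval below [x]; removing the largest element of a chain gives a recursion
([flag_sum_rec]). As the recursion only involves elements below [x], boundaries
and semisuspensions can be compared with the poset that they are cut from
([flag_sum_local]).

Let Omega have rank d+1, let [A a b] be the sum over the chains without element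
of rank d, each one giving a word of length d-1, and let [Y] be the sum of the
ab-indices of the intervals below the coatoms. Then the ab-index of Omega is
[A a b * (a - b) + Y * b]. In an Eulerian poset it does not change when [a] and
[b] are exchanged ([flag_sum_sym]), and neither does [Y]; comparing the two
expressions and cancelling [a - b] gives [Y = A a b + A b a], so that the
ab-index is [A a b * a + A b a * b].

An S-partition distributes the chains counted by [A a b] over the coatoms,
according to the class that contains their largest element. The initial coatom
contributes the ab-index of its boundary, the terminal one nothing. For an
ordinary coatom, the semisuspension has two kinds of chains: those through the
added coatom, and those in Gamma, whose largest element is either in the class
or in the boundary of Gamma; so the coatom contributes the ab-index of the
semisuspension minus [a] times that of the boundary ([flag_sum_interior]).
Thus [A a b = U + V * b], where [V] is the sum of the ab-indices of the
boundaries of the Gammas, and [U] and [V] are unchanged when [a] and [b] are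
exchanged. The ab-index of Omega is then
[(U + V * b) * a + (U + V * a) * b = U * (a + b) + V * (a * b + b * a)],
which is the recursion once the cd-indices of the parts are substituted.

This also produces the cd-index of Omega, by induction on the rank; its
uniqueness is the injectivity of the substitution of [c] and [d]
([cd_subst_inj]). For the signs, the boundary of Gamma is the boundary of the
added coatom, which is the initial coatom of the semisuspension. The difference
in the term of an ordinary coatom is therefore what remains of the recursion
for the semisuspension without its first term, and the induction applies to
this remainder. *)

(** * The substitution of a + b and ab + ba for c and d *)

Section CdSubst.

Let cd_word (w : {fmonom bool}) : ncpoly :=
  \prod_(i <- (w : seq bool))
     (if i then var_a * var_b + var_b * var_a else var_a + var_b).

Fact cd_word_multiplicative : mmorphism cd_word.
Proof. by split=> [w1 w2|]; rewrite /cd_word ?fmM ?big_cat // fm1 big_nil. Qed.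

HB.instance Definition _ :=
  isMultiplicative.Build {fmonom bool} ncpoly cd_word cd_word_multiplicative.

Fact cd_subst_additive : additive cd_subst.
Proof. exact: mmap_is_additive. Qed.

Fact cd_subst_multiplicative : GRing.multiplicative cd_subst.
Proof.
apply: (@commr_mmap_is_multiplicative _ _ _ intr cd_word) => F w w'.
exact/commr_sym/commr_int.
Qed.

HB.instance Definition _ :=
  GRing.isAdditive.Build ncpoly ncpoly cd_subst cd_subst_additive.
HB.instance Definition _ :=
  GRing.isMultiplicative.Build ncpoly ncpoly cd_subst cd_subst_multiplicative.

End CdSubst.

Lemma cd_subst_c : cd_subst var_c = var_a + var_b.
Proof. by rewrite /cd_subst mmapU mul1r fmU big_seq1. Qed.

Lemma cd_subst_d : cd_subst var_d = var_a * var_b + var_b * var_a.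
Proof. by rewrite /cd_subst mmapU mul1r fmU big_seq1. Qed.

(** Products are extended on the right only, because words are analysed by
their last letter in what follows. *)
Lemma nc_ind (Q : ncpoly -> Prop) :
    Q 1 -> (forall F i, Q F -> Q (F * ncvar i)) ->
    (forall F G, Q F -> Q G -> Q (F - G)) -> forall F, Q F.
Proof.
move=> Q1 QM QB.
have Q0 : Q 0 by rewrite -(subrr 1); apply: QB.
have QN F : Q F -> Q (- F) by move=> QF; rewrite -sub0r; apply: QB.
have QD F G : Q F -> Q G -> Q (F + G) by move=> QF QG; rewrite -(opprK G); auto.
have Qword (w : seq bool) : Q << FMonom w >>.
  elim/last_ind: w => [|w i IHw].
    by have -> : << FMonom [::] >> = 1 :> ncpoly; rewrite // -[FMonom _]fmoneE.
  have -> : << FMonom (rcons w i) >> = << FMonom w >> * ncvar i :> ncpoly.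
    rewrite malgM_def fgmulUU mulr1; congr << _ >>.
    by rewrite /mmul /mul /= fmmulE fmU cats1.
  exact: QM.
have Qmul n F : Q F -> Q (F *+ n).
  by move=> QF; elim: n => [|n IHn]; rewrite ?mulr0n // mulrS; auto.
move=> F; rewrite [F]monalgE.
elim/big_rec: _ => [|w G _ QG]; first exact: Q0.
apply: QD => //.
have -> : << F@_w *g w >> = << w >> *~ F@_w :> ncpoly.
  by rewrite -{1}[F@_w]intz; apply: (raddfMz (mkmalgU w)).
by case: (F@_w) => n; rewrite ?NegzE ?mulrNz; [|apply: QN]; apply: Qmul;
  rewrite -[w]fmK.
Qed.

(** Words are sorted by their last letter; uniqueness is [nc_rdecomp0]. *)
Lemma nc_rdecomp (F : ncpoly) :
  exists (k : int) (F0 F1 : ncpoly),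
    F = k%:~R + F0 * ncvar false + F1 * ncvar true.
Proof.
elim/nc_ind: F => [|F [] _|F G [k [F0 [F1 ->]]] [l [G0 [G1 ->]]]].
- by exists 1, 0, 0; rewrite !mul0r !addr0.
- by exists 0, 0, F; rewrite mul0r !add0r.
- by exists 0, F, 0; rewrite mul0r addr0 add0r.
exists (k - l), (F0 - G0), (F1 - G1).
rewrite !mulrBl rmorphB /= !opprD [LHS]addrACA; congr (_ + _).
exact: addrACA.
Qed.

Lemma coeff_mul_var (F : ncpoly) (w : seq bool) i j :
  (F * ncvar i)@_(FMonom (rcons w j)) = F@_(FMonom w) *+ (i == j).
Proof.
rewrite malgM_def fgmulgU raddf_sum /= {3}[F]monalgE raddf_sum -sumrMnl.
apply: eq_bigr => k _; rewrite mulr1 /= !mcoeffU -mulrnA -val_eqE /= fmM fmU.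
by rewrite cats1 eqseq_rcons mulnb -val_eqE.
Qed.

Lemma coeff_mul_var1 (F : ncpoly) i : (F * ncvar i)@_(FMonom [::]) = 0.
Proof.
rewrite malgM_def fgmulgU raddf_sum big1 //= => k _.
by rewrite mcoeffU -val_eqE /= fmM fmU cats1; case: (k : seq bool).
Qed.

Lemma coeff_int (k : int) (w : seq bool) :
  (k%:~R : ncpoly)@_(FMonom w) = k *+ nilp w.
Proof.
rewrite raddfMz /= mcoeff1 -val_eqE /= fm1.
by case: w => [|? ?]; rewrite ?mulr1n ?intz // mul0rz.
Qed.

Lemma coeff_add3 (F G H : ncpoly) w : (F + G + H)@_w = F@_w + G@_w + H@_w.
Proof. by rewrite !mcoeffD. Qed.

Lemma coeff_rdecomp_nil (k : int) (F0 F1 : ncpoly) :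
  (k%:~R + F0 * ncvar false + F1 * ncvar true)@_(FMonom [::]) = k.
Proof.
transitivity (k + 0 + 0 : int); last by rewrite !addr0.
etransitivity; first exact: coeff_add3.
congr (_ + _ + _); [exact: coeff_int | exact: coeff_mul_var1..].
Qed.

Lemma coeff_rdecomp_rcons (k : int) (F0 F1 : ncpoly) (w : seq bool) i :
  (k%:~R + F0 * ncvar false + F1 * ncvar true)@_(FMonom (rcons w i)) =
  (if i then F1 else F0)@_(FMonom w).
Proof.
transitivity (0 + F0@_(FMonom w) *+ ~~ i + F1@_(FMonom w) *+ i).
  etransitivity; first exact: coeff_add3.
  congr (_ + _ + _); first by rewrite coeff_int /nilp size_rcons.
    by rewrite coeff_mul_var; case: (i).
  by rewrite coeff_mul_var; case: (i).
by rewrite add0r; case: i; rewrite ?add0r ?addr0.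
Qed.

Lemma nc_rdecomp0 (k : int) (F0 F1 : ncpoly) :
  k%:~R + F0 * ncvar false + F1 * ncvar true = 0 ->
  [/\ k = 0, F0 = 0 & F1 = 0].
Proof.
move=> F_0; split.
- by rewrite -(coeff_rdecomp_nil k F0 F1) F_0 mcoeff0.
- apply/malgP=> w; rewrite -[w]fmK.
  by have := coeff_rdecomp_rcons k F0 F1 w false; rewrite F_0 !mcoeff0 => <-.
apply/malgP=> w; rewrite -[w]fmK.
by have := coeff_rdecomp_rcons k F0 F1 w true; rewrite F_0 !mcoeff0 => <-.
Qed.

(** A cd-polynomial [k + U c + V d], split by the last letter of its ab-words.
The letter [d] contributes to both parts, with different coefficients, which
is why it can be recovered. *)
Lemma cd_rdecomp (R : nzRingType) (k U V a b : R) :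
  k + U * (a + b) + V * (a * b + b * a) =
  k + (U + V * b) * a + (U + V * a) * b.
Proof.
rewrite !mulrDl !mulrDr !mulrA.
rewrite -[LHS]addrA -[RHS]addrA [V * _ * _ + _]addrC; congr (_ + _).
exact: addrACA.
Qed.

Lemma rmorph_rdecomp (R S : nzRingType) (f : {rmorphism R -> S})
    k F G x y x' y' :
    f x = x' -> f y = y' ->
  f (k%:~R + F * x + G * y) = k%:~R + f F * x' + f G * y'.
Proof. by move=> <- <-; rewrite !rmorphD !rmorphM /= rmorph_int. Qed.

Lemma cd_subst_rdecomp (k : int) (F0 F1 : ncpoly) :
  cd_subst (k%:~R + F0 * var_c + F1 * var_d) =
  k%:~R + (cd_subst F0 + cd_subst F1 * var_b) * var_a
        + (cd_subst F0 + cd_subst F1 * var_a) * var_b.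
Proof.
etransitivity; last exact: cd_rdecomp.
exact: (rmorph_rdecomp _ _ _ cd_subst_c cd_subst_d).
Qed.

Lemma rdecomp_cancel (R : nzRingType) (U V a b : R) :
  U + V * b = 0 -> U + V * a = 0 -> V * (a - b) = 0.
Proof.
move=> UVb UVa; rewrite mulrBr; apply/eqP; rewrite subr_eq0; apply/eqP.
by apply/(@addrI _ U); rewrite UVa.
Qed.

Lemma rdecomp_mul_subr (R : nzRingType) (X a b : R) :
  X * (a - b) = 0 -> 0%:~R + X * a + (- X) * b = 0.
Proof. by rewrite add0r mulNr -mulrBr. Qed.

(** The last letters of the words of [X * a] and of [X * b] differ, so that
nothing can cancel. *)
Lemma mul_sub_ab_eq0 (X : ncpoly) : X * (var_a - var_b) = 0 -> X = 0.
Proof. by move/rdecomp_mul_subr/nc_rdecomp0 => []. Qed.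

(** Comparing last letters in the image of [k + U c + V d] shows that [U + V b]
and [U + V a] vanish, hence [V (a - b)], hence [V] and [U]: a coefficient is
reached by peeling its word off from the right. *)
Lemma cd_subst_eq0 F (w : seq bool) : cd_subst F = 0 -> F@_(FMonom w) = 0.
Proof.
elim/last_ind: w F => [|w i IHw] F; have [k [F0 [F1 ->]]] := nc_rdecomp F.
all: rewrite cd_subst_rdecomp => /nc_rdecomp0[k0 UVb UVa].
  by rewrite coeff_rdecomp_nil.
have V0 := mul_sub_ab_eq0 (rdecomp_cancel UVb UVa).
have U0 : cd_subst F0 = 0.
  by rewrite -[RHS]UVa V0 mul0r [RHS]addr0.
by rewrite coeff_rdecomp_rcons; case: i; [exact: IHw V0 | exact: IHw U0].
Qed.

Lemma cd_subst_inj : injective cd_subst.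
Proof.
apply: raddf_inj => F F_0; apply/malgP=> w.
by rewrite -[w]fmK cd_subst_eq0 // mcoeff0.
Qed.

Lemma cd_regroup (R : nzRingType) (A B U V a b : R) :
  A = U + V * b -> B = U + V * a ->
  U * (a + b) + V * (a * b + b * a) = A * a + B * b.
Proof.
by move=> -> ->; have := cd_rdecomp 0 U V a b; rewrite !add0r.
Qed.

(** [A (a - b) + Y b] and [A' (b - a) + Y a] are the two values, for [(a, b)] and
for [(b, a)], of the ab-index of an Eulerian poset. *)
Lemma regroup_cancel (R : nzRingType) (A A' Y a b : R) :
  A * (a - b) + Y * b = A' * (b - a) + Y * a -> (Y - A - A') * (a - b) = 0.
Proof.
move=> e; rewrite 2!mulrBl.
have -> : Y * (a - b) = A * (a - b) + A' * (a - b).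
  apply/eqP; rewrite mulrBr subr_eq addrAC e -(opprB a b) mulrN.
  by rewrite addrAC addNr add0r.
by rewrite -addrA -opprD subrr.
Qed.

Lemma cd_regroup_top (R : nzRingType) (A A' Y U V a b : R) :
    Y - A - A' = 0 -> A = U + V * b -> A' = U + V * a ->
  A * (a - b) + Y * b = U * (a + b) + V * (a * b + b * a).
Proof.
move=> Y0 defA defA'; rewrite (cd_regroup defA defA') mulrBr -addrA.
rewrite -mulNr -mulrDl.
congr (_ + _ * _); rewrite addrC; exact: subr0_eq.
Qed.

Definition nc_nonneg (F : ncpoly) := forall w, 0 <= F@_w.

Lemma nc_nonneg0 : nc_nonneg 0.
Proof. by move=> w; rewrite mcoeff0. Qed.

Lemma nc_nonneg1 : nc_nonneg 1.
Proof. by move=> w; rewrite mcoeff1; case: eqP. Qed.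

Lemma nc_nonnegD F G : nc_nonneg F -> nc_nonneg G -> nc_nonneg (F + G).
Proof. by move=> F_ge0 G_ge0 w; rewrite mcoeffD addr_ge0. Qed.

Lemma nc_nonneg_mul_var F i : nc_nonneg F -> nc_nonneg (F * ncvar i).
Proof.
move=> F_ge0 w; rewrite -[w]fmK; elim/last_ind: {w}(w : seq bool) => [|w j _].
  by rewrite coeff_mul_var1.
by rewrite coeff_mul_var mulrn_wge0.
Qed.

(** * Chains and ranks *)

Section Chains.
Context {disp : Order.disp_t}.
Implicit Types Omega : finTPOrderType disp.

Lemma is_chainP Omega (C : {set Omega}) :
  reflect {in C &, forall x y, (x >=< y)%O} (is_chain C).
Proof.
apply: (iffP forall_inP) => [h x y Cx Cy | h x Cx].
  exact: (forall_inP (h x Cx)).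
by apply/forall_inP => y Cy; apply: h.
Qed.

Lemma is_chainS Omega (C D : {set Omega}) :
  C \subset D -> is_chain D -> is_chain C.
Proof.
by move=> /subsetP CD /is_chainP h; apply/is_chainP => x y /CD Dx /CD; apply: h.
Qed.

Lemma is_chainU1 Omega (C : {set Omega}) x :
  {in C, forall y, (y <= x)%O} -> is_chain C -> is_chain (x |: C).
Proof.
move=> Cx /is_chainP h; apply/is_chainP => y z.
rewrite !inE => /predU1P[->|Cy] /predU1P[->|Cz].
- exact: comparablexx.
- by rewrite ge_comparable ?Cx.
- by rewrite le_comparable ?Cx.
exact: h.
Qed.

(** A longest chain below [x] can be extended by [x] itself. *)
Lemma rank_lt Omega (x y : Omega) : (x < y)%O -> (rank x < rank y)%N.
Proof.
move=> xy.
pose P := [pred C : {set Omega} | is_chain C && [forall y in C, (y < x)%O]].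
have [|C /andP[chC /forall_inP Cx] rx] := @eq_bigmax_cond _ P (fun C => #|C|).
  apply/card_gt0P; exists set0; rewrite inE; apply/andP; split.
    by apply/is_chainP => ?; rewrite inE.
  by apply/forall_inP => ?; rewrite inE.
have xC : x \notin C by apply/negP => /Cx; rewrite ltxx.
have -> : (rank x).+1 = #|x |: C| by rewrite cardsU1 xC add1n; congr _.+1.
apply: (@leq_bigmax_cond _ _ (fun C : {set Omega} => #|C|)); apply/andP; split.
  by apply: is_chainU1 chC => z /Cx/ltW.
apply/forall_inP => z /setU1P[-> //|/Cx zx]; exact: lt_trans zx xy.
Qed.

Lemma rank_le Omega (x y : Omega) : (x <= y)%O -> (rank x <= rank y)%N.
Proof. by rewrite le_eqVlt => /predU1P[-> //|/rank_lt/ltnW]. Qed.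

Definition has_bottom Omega := exists z : Omega, forall x, (z <= x)%O.

Lemma rank_bottom Omega (z : Omega) : (forall x, (z <= x)%O) -> rank z = 0%N.
Proof.
move=> zmin; apply/eqP; rewrite -leqn0; apply/bigmax_leqP => C /andP[_].
move=> /forall_inP Cz; rewrite leqn0 cards_eq0; apply/eqP/setP => y.
rewrite inE; apply/negP => /Cz/lt_geF.
by rewrite zmin.
Qed.

Lemma rank_eq0 Omega (z : Omega) :
  (forall x, (z <= x)%O) -> forall x, (rank x == 0%N) = (x == z).
Proof.
move=> zmin x; apply/eqP/eqP => [x0|->]; last exact: rank_bottom.
have := zmin x; rewrite le_eqVlt => /predU1P[-> //|/rank_lt].
by rewrite x0.
Qed.

End Chains.

(** * The ab-index of the interval below an element *)

Section FlagSum.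
Context {disp : Order.disp_t} (R : nzRingType).
Implicit Types (Omega : finTPOrderType disp) (a b : R).

(** The condition on the rank excludes the bottom, which occurs in no flag. *)
Definition proper_chains Omega (x : Omega) : {set {set Omega}} :=
  [set C | is_chain C & [forall y in C, (0 < rank y)%N && (y < x)%O]].

Definition chain_weight a b Omega (n : nat) (C : {set Omega}) : R :=
  \prod_(0 <= i < n) (if [exists y in C, rank y == i.+1] then b else a - b).

(** The ab-index of the interval below [x]. The coefficient ring is arbitrary,
so that the two variables can be exchanged. *)
Definition flag_sum a b Omega (x : Omega) : R :=
  \sum_(C in proper_chains x) chain_weight a b (rank x).-1 C.

(** The chains with largest element [y], where the empty chain counts as a chain
with the bottom as largest element. *)
Definition flag_term a b Omega (y : Omega) : R :=
  if rank y == 0%N then 1 else flag_sum a b y * b.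

Lemma proper_chainsP Omega (x : Omega) (C : {set Omega}) :
  reflect (is_chain C /\ {in C, forall y, (0 < rank y)%N /\ (y < x)%O})
          (C \in proper_chains x).
Proof.
rewrite inE; apply: (iffP andP) => -[chC Cx]; split=> //.
  by move=> y Cy; apply/andP; apply: (forall_inP Cx).
by apply/forall_inP => y /Cx/andP.
Qed.

Lemma chain_weight_top a b Omega (y : Omega) n (C : {set Omega}) :
    (0 < rank y <= n)%N -> {in C, forall w, (rank w < rank y)%N} ->
  chain_weight a b n (y |: C) =
  chain_weight a b (rank y).-1 C * b * (a - b) ^+ (n - rank y).
Proof.
case/andP=> y_gt0 y_n Cy; rewrite /chain_weight.
rewrite (big_cat_nat (n := rank y)) //=; congr (_ * _).
  rewrite -[in LHS](prednK y_gt0) big_nat_recr //=; congr (_ * _).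
    rewrite !big_nat; apply: eq_bigr => i /andP[_ i_y].
    congr (if _ then _ else _).
    apply/exists_inP/exists_inP => -[w Cw /eqP wi].
      exists w; last exact/eqP; move: Cw; rewrite !inE => /predU1P[wy|//].
      by move: i_y; rewrite -ltnS prednK // -wi wy ltnn.
    by exists w; [rewrite !inE Cw orbT | exact/eqP].
  by rewrite ifT //; apply/exists_inP; exists y; rewrite ?setU11 // prednK.
rewrite -prodr_const_nat !big_nat; apply: eq_bigr => i /andP[y_i _].
rewrite ifF //; apply/exists_inP => -[w Cw /eqP wi].
suff : (rank w <= rank y)%N by rewrite wi ltnNge y_i.
by move: Cw; rewrite !inE => /predU1P[-> //|/Cy/ltnW].
Qed.

Lemma chain_weight0 a b Omega n :
  chain_weight a b n (set0 : {set Omega}) = (a - b) ^+ n.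
Proof.
rewrite -{2}[n]subn0 -prodr_const_nat; apply: eq_bigr => i _.
by rewrite ifF //; apply/exists_inP => -[w]; rewrite inE.
Qed.

(** The chains are sorted by their largest element [y]: the ranks above that of
[y] each give a factor [a - b]. *)
Lemma flag_sum_rec a b Omega (x : Omega) :
    has_bottom Omega -> (0 < rank x)%N ->
  flag_sum a b x =
  \sum_(y | (y < x)%O) flag_term a b y * (a - b) ^+ ((rank x).-1 - rank y).
Proof.
case=> z zmin x_gt0; have z0 := rank_bottom zmin.
(* The bottom is added so that the empty chain has a largest element too. *)
pose is_top (C : {set Omega}) y :=
  (y \in z |: C) && [forall w in C, (w <= y)%O].
have zx : (z < x)%O.
  by rewrite lt_neqAle zmin andbT eq_sym -(rank_eq0 zmin) -lt0n.
have topP C : C \in proper_chains x ->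
    exists y, [pred y | (y < x)%O && is_top C y] =1 pred1 y.
  case/proper_chainsP => chC Cx.
  have [->|[w0 Cw0]] := set_0Vmem C.
    exists z => y /=; rewrite /is_top setU0 inE andbCA.
    case: eqP => //= ->; rewrite zx; apply/forall_inP => w; by rewrite inE.
  have [y Cy ymax] := @arg_maxnP _ w0 (mem C) (@rank _ Omega) Cw0.
  have {}Cy : y \in C := Cy.
  have yP : [forall w in C, (w <= y)%O].
    apply/forall_inP => w Cw.
    have [//|/rank_lt] := comparable_leP ((is_chainP _ chC) _ _ Cw Cy).
    by rewrite ltnNge; have /= -> := ymax w Cw.
  exists y => u /=; apply/idP/eqP => [/and3P[ux uC uP]|->].
    apply: le_anti; rewrite (forall_inP uP) // andbT.
    by move: uC => /setU1P[->|uC]; [exact: zmin | exact: (forall_inP yP)].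
  by rewrite /is_top yP !inE Cy orbT !andbT; have [] := Cx _ Cy.
transitivity (\sum_(C in proper_chains x) \sum_(y | (y < x)%O && is_top C y)
    chain_weight a b (rank x).-1 C).
  apply: eq_bigr => C /topP[y /(eq_bigl _ _) ->]; by rewrite big_pred1_eq.
rewrite (exchange_big_dep (fun y => (y < x)%O)) /=; last first.
  by move=> C y _ /andP[].
apply: eq_bigr => y yx; rewrite /flag_term (rank_eq0 zmin).
have [->|y_z] := eqVneq y z.
  rewrite (big_pred1 set0) => [|C].
    by rewrite chain_weight0 mul1r z0 subn0.
  rewrite zx /= /is_top setU11 /=; apply/andP/eqP => [[]|->].
    case/proper_chainsP => _ Cx /forall_inP Cz; apply/setP=> w; rewrite inE.
    apply/negP => Cw; have [] := Cx w Cw; rewrite lt0n (rank_eq0 zmin).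
    by rewrite eq_le zmin Cz.
  split; last by apply/forall_inP => w; rewrite inE.
  by apply/proper_chainsP; split=> [|w]; [apply/is_chainP => ? ?|]; rewrite inE.
have y_gt0 : (0 < rank y)%N by rewrite lt0n (rank_eq0 zmin).
have y_n : (rank y <= (rank x).-1)%N by rewrite -ltnS prednK // rank_lt.
rewrite (reindex_onto (fun C => y |: C) (fun C => C :\ y)) /=; last first.
  move=> C /and3P[_ _ /andP[/setU1P[yz|Cy] _]]; last exact: setD1K.
  by rewrite yz eqxx in y_z.
rewrite /flag_sum !mulr_suml.
apply: etrans (eq_bigr _ _) => [|C]; first apply: eq_bigl => C; last first.
  case/proper_chainsP => _ Cy; apply: chain_weight_top; first by rewrite y_gt0.
  by move=> w /Cy[_ /rank_lt].
rewrite yx /=; apply/idP/idP.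
  case/andP=> /andP[/proper_chainsP[chC Cx] /andP[_ /forall_inP topC]] /eqP CE.
  have yC : y \notin C by rewrite -CE !inE eqxx.
  apply/proper_chainsP; split; first by apply: is_chainS chC; apply: subsetUr.
  move=> w Cw; have CwU : w \in y |: C by rewrite inE Cw orbT.
  split; first by have [] := Cx w CwU.
  by rewrite lt_neqAle topC // andbT; apply: contraNneq yC => <-.
case/proper_chainsP=> chC Cy.
have yC : y \notin C by apply/negP => /Cy[_]; rewrite ltxx.
rewrite setU1K // eqxx andbT /is_top !inE eqxx orbT /=; apply/andP; split.
  apply/andP; split; first by apply: is_chainU1 chC => w /Cy[_ /ltW].
  apply/forall_inP => w /setU1P[->|/Cy[-> wy]]; first by rewrite y_gt0.
  exact: lt_trans wy yx.
by apply/forall_inP => w /setU1P[->//|/Cy[_ /ltW]].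
Qed.

End FlagSum.

(** * Eulerian posets: exchanging a and b *)

Section Symmetry.
Context {disp : Order.disp_t} (R : nzRingType).
Implicit Types (Omega : finTPOrderType disp) (a b : R).

(** The term [y = x] is [flag_sum a b x * b], and by the recursion the others
add up to [flag_sum a b x * (a - b)]. The right-hand side is [flag_term b a x]
when [flag_sum] is symmetric at [x]: this drives the induction in
[flag_sum_sym]. *)
Lemma flag_term_le a b Omega (x : Omega) : has_bottom Omega ->
  \sum_(y | (y <= x)%O) flag_term a b y * (a - b) ^+ (rank x - rank y) =
  if rank x == 0%N then 1 else flag_sum a b x * a.
Proof.
move=> bot; rewrite (bigD1 x) //= subnn mulr1 {1}/flag_term.
have [x0|x_neq0] := eqVneq (rank x) 0%N.
  rewrite big1 ?addr0 // => y; rewrite andbC -lt_neqAle => /rank_lt.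
  by rewrite x0.
have x_gt0 : (0 < rank x)%N by rewrite lt0n.
rewrite -[X in _ = _ * X](addrNK b a) mulrDr addrC; congr (_ + _).
rewrite (flag_sum_rec _ _ bot x_gt0) mulr_suml.
apply: eq_big => [y|y]; first by rewrite lt_neqAle andbC.
rewrite andbC -lt_neqAle => /rank_lt yx; rewrite -mulrA -exprSr.
congr (_ * _ ^+ _).
by lia.
Qed.

Lemma eulerian_sign Omega (z x : Omega) : eulerian Omega -> (z < x)%O ->
  \sum_(y | (z <= y)%O && (y < x)%O) (-1) ^+ ((rank x).-1 - rank y) = 1 :> R.
Proof.
case=> _ eul zx.
have x_gt0 : (0 < rank x)%N := leq_ltn_trans (leq0n _) (rank_lt zx).
have alt_sum : \sum_(y | (z <= y <= x)%O) (-1) ^+ rank y = 0 :> R.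
  rewrite (bigID (fun y => odd (rank y))) /=.
  under eq_bigr => y /andP[_ yo] do rewrite -signr_odd yo expr1.
  under [X in _ + X]eq_bigr => y /andP[_ /negbTE yo]
    do rewrite -signr_odd yo expr0.
  have := eul z x zx; rewrite !cardsE => eq_card.
  by rewrite !sumr_const eq_card mulNrn addrC subrr.
rewrite (bigD1 x) /= ?(ltW zx) ?lexx // in alt_sum.
move/eqP: alt_sum; rewrite addrC addr_eq0 => /eqP alt_sum.
transitivity ((-1) ^+ (rank x).-1 *
    \sum_(y | (z <= y <= x)%O && (y != x)) (-1) ^+ rank y : R).
  rewrite mulr_sumr; apply: eq_big => [y|y /andP[_ /rank_lt yx]].
    by rewrite lt_neqAle -andbA [(y <= x)%O && _]andbC.
  rewrite -exprD -signr_odd oddB -1?ltnS ?prednK // -oddD signr_odd.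
  by [].
by rewrite alt_sum -{2}(prednK x_gt0) exprS mulN1r opprK -expr2 sqrr_sign.
Qed.

(** By induction, [flag_term_le] expands each term [flag_term b a y] of the
recursion as a sum over [z <= y]. Since [b - a = - (a - b)], the coefficient of
[flag_term a b z] in the resulting double sum is, up to a power of [a - b], the
alternating count of the [y] in the interval from [z] to [x], [x] excluded;
this is 1 in an Eulerian poset. *)
Lemma flag_sum_sym a b Omega (x : Omega) : eulerian Omega -> (0 < rank x)%N ->
  flag_sum a b x = flag_sum b a x.
Proof.
move=> eul; have bot : has_bottom Omega by case: eul => -[].
have [n] := ubnP (rank x); elim: n x => // n IHn x /ltnSE xn x_gt0.
rewrite [RHS]flag_sum_rec //.
transitivity (\sum_(y | (y < x)%O) \sum_(z | (z <= y)%O)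
   flag_term a b z * (a - b) ^+ ((rank x).-1 - rank z) *
     (-1) ^+ ((rank x).-1 - rank y)).
  rewrite (exchange_big_dep (fun z => (z < x)%O)) /=; last first.
    by move=> y z yx zy; apply: le_lt_trans zy yx.
  rewrite flag_sum_rec //; apply: eq_bigr => z zx.
  rewrite -mulr_sumr (eq_bigl _ _ (fun y => andbC _ _)).
  by rewrite eulerian_sign // mulr1.
apply: eq_bigr => y yx; have := rank_lt yx => ryx.
have -> : flag_term b a y = if rank y == 0%N then 1 else flag_sum a b y * a.
  rewrite /flag_term; have [//|y_neq0] := eqVneq (rank y) 0%N.
  by rewrite IHn ?lt0n //; apply: leq_trans xn.
rewrite -flag_term_le // mulr_suml; apply: eq_bigr => z zy.
rewrite -(opprB a b) (exprNn (a - b)) -!mulrA; congr (_ * _).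
rewrite [RHS]mulrA [in RHS]commr_sign -mulrA -exprD commr_sign.
by congr (_ * _ ^+ _); have := rank_le zy; lia.
Qed.

End Symmetry.

(** * The ab-index of an interval depends on the interval only *)

Section Locality.
Context {disp : Order.disp_t} (A B : finTPOrderType disp).
Variables (f : A -> B) (D : {pred A}).
Hypothesis D_down : forall x y, x \in D -> (y <= x)%O -> y \in D.
Hypothesis f_le : {in D &, forall x y, (f x <= f y)%O = (x <= y)%O}.
Hypothesis f_onto : forall x z, x \in D -> (z <= f x)%O ->
  exists2 y, y \in D & z = f y.

Let f_inj : {in D &, injective f}.
Proof. by move=> x y Dx Dy fxy; apply: le_anti; rewrite -!f_le // fxy lexx. Qed.

Let f_lt : {in D &, forall x y, (f x < f y)%O = (x < y)%O}.
Proof. by move=> x y Dx Dy; rewrite !lt_neqAle f_le // (inj_in_eq f_inj). Qed.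

Let chains_below (P : finTPOrderType disp) (x : P) : {set {set P}} :=
  [set C | is_chain C & [forall y in C, (y < x)%O]].

Let chains_belowP (P : finTPOrderType disp) (x : P) (C : {set P}) :
  reflect (is_chain C /\ {in C, forall y, (y < x)%O}) (C \in chains_below x).
Proof.
by rewrite inE; apply: (iffP andP) => -[chC /forall_inP].
Qed.

Let sub_D x C : x \in D -> C \in chains_below x -> {subset C <= D}.
Proof. by move=> Dx /chains_belowP[_ Cx] y /Cx/ltW; apply: D_down. Qed.

Let imset_inj x : x \in D ->
  {in chains_below x &, injective (fun C : {set A} => f @: C)}.
Proof.
move=> Dx; suff sub C C' : C \in chains_below x -> C' \in chains_below x ->
    f @: C = f @: C' -> C \subset C'.
  by move=> C C' Cx C'x e; apply/eqP; rewrite eqEsubset !sub.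
move=> /(sub_D Dx) CD /(sub_D Dx) CD' e; apply/subsetP => y Cy.
have: f y \in f @: C' by rewrite -e imset_f.
by case/imsetP => w C'w /f_inj ->; auto.
Qed.

Let chains_below_image x : x \in D ->
  chains_below (f x) = [set f @: C | C : {set A} in chains_below x].
Proof.
move=> Dx; apply/setP => C; apply/chains_belowP/imsetP => [[chC Cfx]|[C']].
  have fD y : y \in C -> exists2 w, w \in D & y = f w.
    by move=> Cy; apply: (f_onto Dx); apply/ltW/Cfx.
  exists [set w in D | f w \in C].
    apply/chains_belowP; split.
      apply/is_chainP => v w; rewrite !inE => /andP[Dv Cv] /andP[Dw Cw].
      by rewrite /Order.comparable -!f_le //; apply: (is_chainP _ chC).
    by move=> w; rewrite inE => /andP[Dw /Cfx]; rewrite f_lt.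
  apply/setP => y; apply/idP/imsetP => [Cy|[w]].
    by have [w Dw yw] := fD y Cy; exists w; rewrite // inE Dw -yw.
  by rewrite inE => /andP[_ Cw ->].
move=> C'x ->; have C'D := sub_D Dx C'x; case/chains_belowP: C'x => chC' C'x.
split; last by move=> _ /imsetP[w C'w ->]; rewrite f_lt; auto.
apply/is_chainP => _ _ /imsetP[v C'v ->] /imsetP[w C'w ->].
by rewrite /Order.comparable !f_le; auto; apply: (is_chainP _ chC').
Qed.

Lemma rank_local x : x \in D -> rank (f x) = rank x.
Proof.
move=> Dx; rewrite /rank.
transitivity (\max_(C in chains_below (f x)) #|C|)%N.
  by apply: eq_bigl => C; rewrite inE.
rewrite chains_below_image // big_imset; last exact: imset_inj.
rewrite [RHS](eq_bigl [in chains_below x]); last by move=> C; rewrite inE.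
apply: eq_bigr => C /(sub_D Dx) CD; apply: card_in_imset.
exact: sub_in2 f_inj.
Qed.

(** The chains below [x] and below [f x] correspond, with the same ranks. *)
Lemma flag_sum_local (R : nzRingType) (a b : R) x :
  x \in D -> flag_sum a b (f x) = flag_sum a b x.
Proof.
move=> Dx; rewrite /flag_sum rank_local //.
have proper_chainsE (P : finTPOrderType disp) (y : P) C :
    (C \in proper_chains y) =
    (C \in chains_below y) && [forall w in C, (0 < rank w)%N].
  apply/proper_chainsP/andP
    => [[chC Cy]|[/chains_belowP[chC Cy] /forall_inP C0]].
    split; last by apply/forall_inP => w /Cy[].
    by apply/chains_belowP; split=> // w /Cy[].
  by split=> // w Cw; split; auto.
rewrite [RHS](eq_bigl _ _ (proper_chainsE _ _)).
rewrite (eq_bigl _ _ (proper_chainsE _ _)).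
rewrite !big_mkcondr /= chains_below_image // big_imset; last exact: imset_inj.
apply: eq_bigr => C /(sub_D Dx) CD; congr (if _ then _ else _).
  apply/forall_inP/forall_inP => C0 w Cw.
    by rewrite -rank_local; auto; apply/C0/imset_f.
  by case/imsetP: Cw => v Cv ->; rewrite rank_local; auto.
apply: eq_bigr => i _; congr (if _ then _ else _).
apply/exists_inP/exists_inP => -[w].
  by case/imsetP=> v Cv ->; rewrite rank_local; auto => vi; exists v.
by move=> Cw wi; exists (f w); rewrite ?imset_f ?rank_local; auto.
Qed.

Lemma flag_term_local (R : nzRingType) (a b : R) x :
  x \in D -> flag_term a b (f x) = flag_term a b x.
Proof. by move=> Dx; rewrite /flag_term rank_local // flag_sum_local. Qed.

End Locality.

(** * The ab-index as a sum over chains *)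

Lemma prod_eq0_seq (R : nzRingType) (I : eqType) (r : seq I) (F : I -> R) i :
  i \in r -> F i = 0 -> \prod_(j <- r) F j = 0.
Proof.
move=> ri Fi; elim: r ri => // j r IHr.
rewrite inE big_cons => /predU1P[<-|/IHr->].
  by rewrite Fi mul0r.
by rewrite mulr0.
Qed.

Lemma prod_sign_seq (R : nzRingType) (I : Type) (r : seq I)
    (P : pred I) (F : I -> R) :
  \prod_(i <- r) (if P i then - F i else F i) =
  (-1) ^+ (\sum_(i <- r) P i) * \prod_(i <- r) F i.
Proof.
elim: r => [|i r IHr]; first by rewrite !big_nil mulr1.
rewrite !big_cons IHr exprD [LHS]mulrA [RHS]mulrA; congr (_ * _).
rewrite [LHS]commr_sign; case: (P i); last by rewrite expr0 mul1r.
by rewrite expr1 mulN1r mulrN mulNr.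
Qed.

(** Each factor is written as the sum of a multiple of [b] and a multiple of [a],
[b + 0] or [- b + a]; the set K records where [b] is chosen. *)
Lemma prod_flag_expansion (R : nzRingType) (a b : R) d (T : {set 'I_d}) :
  \prod_(i < d) (if i \in T then b else a - b) =
  \sum_(K : {set 'I_d} | T \subset K)
     (-1) ^+ #|K :\: T| * \prod_(i < d) (if i \in K then b else a).
Proof.
transitivity (\prod_(i < d) ((if i \in T then b else - b) +
                             (if i \in T then 0 else a))).
  by apply: eq_bigr => i _; case: ifP => _; rewrite ?addr0 // addrC.
rewrite bigA_distr [RHS]big_mkcond; apply: eq_bigr => K _.
case: ifPn => [TK|/subsetPn[i Ti Ki]]; last first.
  apply: (@prod_eq0_seq _ _ _ _ i); rewrite ?mem_index_enum //.
  by rewrite (negbTE Ki) Ti.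
transitivity (\prod_(i < d) if i \in K :\: T then - (if i \in K then b else a)
                            else if i \in K then b else a).
  apply: eq_bigr => i _; rewrite inE; case: ifP => Ki; rewrite ?andbT ?andbF //.
    by case: ifP.
  by rewrite ifF //; apply: contraFF Ki; apply: (subsetP TK).
rewrite prod_sign_seq; congr ((-1) ^+ _ * _).
by rewrite -sum1_card [RHS]big_mkcond; apply: eq_bigr => i _; case: ifP.
Qed.

Lemma inclusion_exclusion_exchange (V : lmodType int) (I : finType)
    (s : {set I} -> {set I} -> int) (f : {set I} -> nat) (m : {set I} -> V) :
  \sum_(K : {set I})
     (\sum_(T : {set I} | T \subset K) s K T * (f T)%:Z) *: m K =
  \sum_(T : {set I}) (\sum_(K : {set I} | T \subset K) s K T *: m K) *+ f T.
Proof.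
under eq_bigr => K _ do rewrite scaler_suml.
rewrite (exchange_big_dep predT) //=; apply: eq_bigr => T _.
rewrite -sumrMnl; apply: eq_bigr => K _.
by rewrite mulrC -scalerA -natz scaler_nat.
Qed.

Section AbIndex.
Context {disp : Order.disp_t} (Omega : finTPOrderType disp).
Local Notation d := (dimension Omega).

Definition chain_type (C : {set Omega}) : {set 'I_d} :=
  [set i : 'I_d | [exists y in C, rank y == i.+1]].

Lemma rank_inj_chain (C : {set Omega}) :
  is_chain C -> {in C &, injective (@rank _ Omega)}.
Proof.
move/is_chainP => chC x y Cx Cy xy.
by case: (comparable_ltgtP (chC _ _ Cx Cy)) => // /rank_lt; rewrite xy ltnn.
Qed.

(** Ranks are injective on a chain, so its multiset of ranks is as good as the
set of ranks, and a chain whose ranks are in [1, d] avoids bottom and top. *)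
Lemma flag_f_card (T : {set 'I_d}) :
  flag_f T = #|[set C in proper_chains (\top%O : Omega) | chain_type C == T]|.
Proof.
apply: eq_card => C; rewrite !inE; apply/idP/idP.
  case/andP=> chC /perm_mem CT.
  have CT' i : (i \in chain_type C) = (i \in T).
    rewrite inE; apply/exists_inP/idP => [[y Cy /eqP yi]|Ti].
      have : rank y \in [seq (val i).+1 | i in T].
        by rewrite -CT; apply: image_f.
      by case/imageP => j Tj; rewrite yi => -[/val_inj->].
    have : (val i).+1 \in [seq rank x | x in C] by rewrite CT; apply: image_f.
    by case/imageP => y Cy ->; exists y.
  rewrite chC /=; apply/andP; split; last by apply/eqP/setP.
  apply/forall_inP => y Cy.
  have : rank y \in [seq rank x | x in C] by apply: image_f.
  rewrite CT => /imageP[j _ yj]; rewrite yj /= lt_neqAle lex1 andbT.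
  apply/eqP => ytop; have : ((rank y).-1 < d)%N by rewrite yj /=.
  by rewrite ytop ltnn.
case/andP => /andP[chC /forall_inP Cpos] /eqP <-; rewrite chC /=.
apply: uniq_perm.
- rewrite map_inj_in_uniq ?enum_uniq // => x y; rewrite !mem_enum.
  exact: rank_inj_chain.
- by rewrite map_inj_uniq ?enum_uniq // => i j [/val_inj].
move=> n; apply/imageP/imageP => -[].
  move=> y Cy ->; have /andP[y0 /rank_lt yt] := Cpos y Cy.
  have yd : ((rank y).-1 < d)%N.
    by rewrite /dimension -ltnS !prednK // (leq_ltn_trans _ yt).
  exists (Ordinal yd); rewrite /= ?prednK // inE.
  apply/exists_inP; exists y => //=.
  by rewrite prednK.
by move=> i; rewrite inE => /exists_inP[y Cy /eqP <-] ->; exists y.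
Qed.

Lemma ab_indexE : ab_index Omega = flag_sum var_a var_b (\top%O : Omega).
Proof.
apply: etrans (inclusion_exclusion_exchange _ _ _) _.
rewrite /flag_sum (partition_big chain_type predT) //=; apply: eq_bigr => T _.
transitivity ((\prod_(i < d) (if i \in T then var_b else var_a - var_b))
              *+ flag_f T).
  congr (_ *+ _); rewrite prod_flag_expansion; apply: eq_bigr => K _.
  by rewrite -signr_odd scaler_sign -signr_odd mulr_sign.
rewrite flag_f_card -sumr_const; apply: eq_big => [C|C].
  by rewrite inE.
rewrite inE => /andP[_ /eqP <-]; rewrite /chain_weight big_mkord.
by apply: eq_bigr => i _; rewrite inE.
Qed.

End AbIndex.

(** * Boundaries and semisuspensions *)

Section Embeddings.
Context {disp : Order.disp_t}.
Implicit Types (Omega Gamma : finTPOrderType disp).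

Lemma in_coatom_boundary Omega (s x : Omega) :
  (x \in lower_closure [set s] :\ s) = (x < s)%O.
Proof.
rewrite !inE lt_neqAle; congr (_ && _); apply/exists_inP/idP => [[p]|xs].
  by rewrite inE => /eqP->.
by exists s; rewrite ?inE.
Qed.

Section CoatomBoundary.
Variables (Omega : finTPOrderType disp) (s : Omega).

Let incl (u : coatom_boundary s) : Omega := oapp val s u.

Let incl_le (u v : coatom_boundary s) : (incl u <= incl v)%O = (u <= v)%O.
Proof.
have lt_s (x : {x | x \in lower_closure [set s] :\ s}) : (val x < s)%O.
  by rewrite -in_coatom_boundary; apply: valP.
case: u v => [x|] [y|]; rewrite /incl /=.
- by [].
- by rewrite ltW // lt_s.
- by rewrite lt_geF // lt_s.
by rewrite lexx.
Qed.

Let incl_onto (u : coatom_boundary s) z :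
  (z <= incl u)%O -> exists2 v, v \in predT & z = incl v.
Proof.
move=> zu; have zs : (z <= s)%O.
  apply: le_trans zu _.
  rewrite -[X in (_ <= X)%O]/(incl (None : coatom_boundary s)).
  by rewrite incl_le; case: u.
have [->|z_s] := eqVneq z s; first by exists None.
have zL : z \in lower_closure [set s] :\ s.
  by rewrite in_coatom_boundary lt_neqAle z_s.
by exists (Some (exist _ z zL)).
Qed.

Lemma flag_sum_coatom_boundary (R : nzRingType) (a b : R) :
  flag_sum a b (\top%O : coatom_boundary s) = flag_sum a b s.
Proof.
symmetry; apply: (@flag_sum_local _ _ _ incl predT _ _ _ _ _ _ None) => //.
by move=> u z _; apply: incl_onto.
Qed.

End CoatomBoundary.

Section GammaBoundary.
Variables (Gamma : finTPOrderType disp).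

Let incl (u : boundary_poset Gamma) : semisuspension Gamma := omap val u.

Let incl_le (u v : boundary_poset Gamma) : (incl u <= incl v)%O = (u <= v)%O.
Proof.
case: u v => [x|] [y|] //=.
- exact: (valP x).
apply/negP => /= /eqP yt; have := valP y; rewrite /= yt.
exact/negP/top_notin_boundary.
Qed.

Let incl_onto (u : boundary_poset Gamma) z :
  (z <= incl u)%O -> exists2 v, v \in predT & z = incl v.
Proof.
move=> zu; have zt : (z <= added_coatom Gamma)%O.
  apply: le_trans zu _.
  rewrite -[X in (_ <= X)%O]/(incl (None : boundary_poset Gamma)).
  by rewrite incl_le; case: (u).
case: z zt {zu} => [x|] /= zt; last by exists None.
by exists (Some (exist _ x zt)).
Qed.

Lemma flag_sum_added_coatom (R : nzRingType) (a b : R) :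
  flag_sum a b (added_coatom Gamma) =
  flag_sum a b (\top%O : boundary_poset Gamma).
Proof.
apply: (@flag_sum_local _ _ _ incl predT _ _ _ _ _ _ None) => //.
by move=> u z _; apply: incl_onto.
Qed.

End GammaBoundary.

Section SuspensionFace.
Variables (Omega : finTPOrderType disp) (L : {set Omega}).
Hypothesis L_down : forall x y : Omega, (x <= y)%O -> y \in L -> x \in L.
Local Notation susp := (semisuspension (lower_poset L)).

Definition suspension_face (x : {x : Omega | x \in L}) : susp := Some (Some x).

Let forget (u : susp) : Omega := if u is Some (Some x) then val x else \top%O.
Let faces : {pred susp} := fun u => if u is Some (Some _) then true else false.

Let forget_rules :
  [/\ forall u v : susp, u \in faces -> (v <= u)%O -> v \in faces,
      {in faces &, forall u v, (forget u <= forget v)%O = (u <= v)%O}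
    & forall u z, u \in faces -> (z <= forget u)%O ->
        exists2 v, v \in faces & z = forget v].
Proof.
split.
- by case=> [[x|]|] [[y|]|].
- by case=> [[x|]|] [[y|]|].
case=> [[x|]|] // z _ /= zx.
by exists (suspension_face (exist _ z (L_down zx (valP x)))).
Qed.

Lemma rank_suspension_face x : rank (suspension_face x) = rank (val x).
Proof. by have [h1 h2 h3] := forget_rules; rewrite -(rank_local h1 h2 h3). Qed.

Lemma flag_term_suspension_face (R : nzRingType) (a b : R) x :
  flag_term a b (suspension_face x) = flag_term a b (val x).
Proof.
by have [h1 h2 h3] := forget_rules; rewrite -(flag_term_local h1 h2 h3).
Qed.

End SuspensionFace.

End Embeddings.

(** * The contributions of the coatoms *)

Section Decomposition.
Context {disp : Order.disp_t}.
Implicit Types (Omega Gamma : finTPOrderType disp).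

Lemma lt_top_rank Omega (x : Omega) :
  (x < \top)%O = (rank x < poset_rank Omega)%N.
Proof.
apply/idP/idP => [/rank_lt //|]; rewrite lt_neqAle lex1 andbT.
by apply: contraL => /eqP ->; rewrite ltnn.
Qed.

Lemma big_sub_val (V : nmodType) (T : finType) (L : {set T})
    (P : pred T) (F : T -> V) :
  {subset P <= L} ->
  \sum_(x | P x) F x = \sum_(x : {x | x \in L} | P (val x)) F (val x).
Proof.
pose in_L : T -> option {x | x \in L} := insub.
move=> PL; rewrite (@reindex_omap _ _ _ _ _ val in_L).
  by apply: eq_bigl => x; rewrite /in_L valK eqxx andbT.
by move=> x Px; rewrite /in_L; case: insubP => [y _ <-|] //; rewrite (PL x Px).
Qed.

Section Suspension.
Variables (Omega : finTPOrderType disp) (L : {set Omega}).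
Hypothesis L_down : forall x y : Omega, (x <= y)%O -> y \in L -> x \in L.
Local Notation Gamma := (lower_poset L : finTPOrderType disp).
Local Notation susp := (semisuspension Gamma : finTPOrderType disp).

Lemma big_suspension_faces (V : nmodType) (P : pred susp) (F : susp -> V) :
    ~~ P None -> ~~ P (Some None) ->
  \sum_(u | P u) F u =
  \sum_(x | P (suspension_face x)) F (suspension_face x).
Proof.
move=> PN PSN.
pose back (u : susp) : option {x | x \in L} := if u is Some v then v else None.
rewrite (@reindex_omap _ _ _ _ _ (@suspension_face _ _ L) back).
  by apply: eq_bigl => x; rewrite eqxx andbT.
by case=> [[x|]|] Pu //; move: Pu; rewrite ?(negbTE PN) ?(negbTE PSN).
Qed.

Variables (R : nzRingType) (a b : R) (n : nat).
Hypothesis susp_bot : has_bottom susp.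
Hypothesis susp_rank : poset_rank susp = n.+2.
Hypothesis tau_rank : rank (added_coatom Gamma) = n.+1.

(** With [T] the ab-index of the boundary and [S] the sum over all the faces of
Gamma, the ab-index of the semisuspension is [T b + S]: the chains through the
added coatom, and the others. By the recursion at the added coatom, the
boundary faces account for [T (a - b)] in [S], which leaves [S - T (a - b)]. *)
Lemma flag_sum_interior :
  \sum_(x : {x | x \in L} | Some x \notin boundary Gamma)
     flag_term a b (val x) * (a - b) ^+ (n.+1 - rank (val x)) =
  flag_sum a b (\top%O : susp)
    - flag_sum a b (\top%O : boundary_poset Gamma) * a.
Proof.
pose G (x : {x | x \in L}) :=
  flag_term a b (val x) * (a - b) ^+ (n.+1 - rank (val x)).
have tau_top : (added_coatom Gamma < \top :> susp)%O.
  by rewrite lt_top_rank susp_rank tau_rank.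
have lt_tau x :
    (suspension_face x < added_coatom Gamma)%O = (Some x \in boundary Gamma).
  by rewrite lt_neqAle.
have sum_top : flag_sum a b (\top%O : susp) =
    flag_sum a b (\top%O : boundary_poset Gamma) * b + \sum_x G x.
  rewrite flag_sum_rec //; last by rewrite -/(poset_rank susp) susp_rank.
  rewrite -/(poset_rank susp) susp_rank (bigD1 (added_coatom Gamma)) //=.
  rewrite tau_rank subnn mulr1 {1}/flag_term tau_rank flag_sum_added_coatom.
  congr (_ + _); rewrite big_suspension_faces ?eqxx ?andbF //.
  apply: eq_big => [x|x _].
    by rewrite lt_neqAle lex1 andbT.
  by rewrite flag_term_suspension_face // rank_suspension_face.
have sum_tau : flag_sum a b (\top%O : boundary_poset Gamma) * (a - b) =
    \sum_(x : {x | x \in L} | Some x \in boundary Gamma) G x.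
  rewrite -flag_sum_added_coatom flag_sum_rec ?tau_rank // mulr_suml.
  rewrite big_suspension_faces ?ltxx ?(lt_gtF tau_top) //.
  apply: eq_big => // x /rank_lt.
  rewrite tau_rank rank_suspension_face // => xn.
  rewrite flag_term_suspension_face // /G -mulrA -exprSr; congr (_ * _ ^+ _).
  by rewrite subSn.
rewrite (bigID [pred x | Some x \in boundary Gamma]) /= -sum_tau in sum_top.
rewrite sum_top.
by rewrite addrA -mulrDr subrKC addrAC subrr add0r.
Qed.

End Suspension.

Section Partition.
Variables (Omega : finTPOrderType disp).
Variable R : nzRingType.
Implicit Types a b : R.

(** The chains without element of rank d, sorted by their largest element; the
words have length d-1, the factor for the rank d being left out. *)
Definition lower_flag_sum a b : R :=
  \sum_(y : Omega | ((rank y).+1 < poset_rank Omega)%N)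
     flag_term a b y * (a - b) ^+ ((poset_rank Omega).-2 - rank y).

Lemma flag_sum_top a b : has_bottom Omega -> (2 <= poset_rank Omega)%N ->
  flag_sum a b (\top%O : Omega) =
  lower_flag_sum a b * (a - b) + (\sum_(s in coatoms Omega) flag_sum a b s) * b.
Proof.
move=> bot rk2; rewrite flag_sum_rec -/(poset_rank Omega) ?(ltnW rk2) //.
rewrite (bigID (fun y => (rank y).+1 < poset_rank Omega)%N) /= !mulr_suml.
congr (_ + _); apply: eq_big => y.
- by rewrite lt_top_rank; lia.
- by case/andP=> _ yr; rewrite -mulrA -exprSr; congr (_ * _ ^+ _); lia.
- by rewrite lt_top_rank inE; lia.
case/andP=> _; rewrite -leqNgt => yr.
have -> : ((poset_rank Omega).-1 - rank y = 0)%N by lia.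
by rewrite mulr1 /flag_term ifF //; lia.
Qed.

(** The largest elements of these chains are exactly the elements of the classes
other than the coatoms themselves. *)
Lemma lower_flag_sum_partition (P : Omega -> {set Omega}) s1 st a b :
  S_partition P s1 st ->
  lower_flag_sum a b =
    flag_sum a b (\top%O : coatom_boundary s1) +
    \sum_(s in ordinary s1 st)
       (flag_sum a b (\top%O : Gamma_suspension P s)
        - flag_sum a b (\top%O : Gamma_boundary P s) * a).
Proof.
case=> {}P {}s1 {}st eul rk2 [P_inj P_part P_sub] [[s1_co P_s1] s1_uniq] _ _
  [[st_co P_st] st_uniq] near susp.
have bot : has_bottom Omega by case: eul => -[].
pose E (y : Omega) :=
  flag_term a b y * (a - b) ^+ ((poset_rank Omega).-2 - rank y).
have co_rank s : s \in coatoms Omega -> rank s = (poset_rank Omega).-1.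
  by rewrite inE => /eqP <-.
have P_le s y : s \in coatoms Omega -> y \in P s -> (y <= s)%O.
  move=> s_co /(subsetP (P_sub s s_co)); rewrite inE => /exists_inP[p].
  by rewrite inE => /eqP ->.
have s1_neq_st : s1 != st.
  apply/eqP => s1st; case: bot => z zmin.
  have : z \in P st.
    by rewrite -s1st P_s1 inE; apply/exists_inP; exists s1; rewrite ?inE.
  by rewrite P_st inE eq_sym -(rank_eq0 zmin) co_rank //; lia.
have -> : lower_flag_sum a b =
    \sum_(s in coatoms Omega) \sum_(y in P s :\ s) E y.
  transitivity (\sum_(y in [set~ \top%O]
                     | ((rank y).+1 < poset_rank Omega)%N) E y).
    apply: eq_bigl => y; rewrite !inE; case: eqP => // ->; apply/negbTE.
    by rewrite /poset_rank -leqNgt.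
  rewrite (set_partition_big_cond _ P_part) big_imset //=.
  apply: eq_bigr => s s_co; apply: eq_bigl => y.
  rewrite !inE andbC; apply: andb_id2r => Psy.
  have [->|y_s] := eqVneq y s; first by rewrite co_rank //; lia.
  have /rank_lt : (y < s)%O by rewrite lt_neqAle y_s P_le.
  rewrite (co_rank s) //; lia.
(* The terminal class has no element besides its coatom. *)
rewrite (bigD1 s1) //= [X in _ + X](bigD1 st) /=; last by rewrite st_co eq_sym.
rewrite P_st setDv big_set0 add0r; congr (_ + _).
  rewrite P_s1 flag_sum_coatom_boundary flag_sum_rec ?co_rank //; last by lia.
  by apply: eq_bigl => y; rewrite in_coatom_boundary.
apply: eq_big => s; first by rewrite !inE negb_or [RHS]andbC andbA.
case/andP=> /andP[s_co s_s1] s_st; have s_ord : s \in ordinary s1 st.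
  by rewrite in_setD s_co andbT !inE negb_or s_s1 s_st.
have [_ _ Gamma_union Gamma_disj] := near s s_ord.
have [susp_rank [Q [t hQ]]] := susp s s_ord.
have [susp_bot tau_co susp_rk2] : [/\ has_bottom (Gamma_suspension P s),
    added_coatom (Gamma_poset P s) \in coatoms (Gamma_suspension P s)
  & (2 <= poset_rank (Gamma_suspension P s))%N].
  by case: hQ => ? ? ? [[bot' _] _] ? _ [[? _] _] *; split.
have L_down x y : (x <= y)%O -> y \in Gamma_set P s -> x \in Gamma_set P s.
  move=> xy; rewrite !inE => /exists_inP[p Pp yp].
  by apply/exists_inP; exists p => //; apply: le_trans yp.
have [n rkS] : exists n, poset_rank (Gamma_suspension P s) = n.+2.
  by move: susp_rk2; case: (poset_rank _) => [|[|n]] // _; exists n.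
have rkO : poset_rank Omega = n.+3 by rewrite -susp_rank rkS.
have tau_rk : rank (added_coatom (Gamma_poset P s)) = n.+1.
  by move: tau_co; rewrite inE rkS => /eqP[].
rewrite -(flag_sum_interior L_down a b susp_bot rkS tau_rk).
rewrite (@big_sub_val _ _ (Gamma_set P s)); last first.
  by move=> y Py; rewrite Gamma_union inE; apply/orP; left.
apply: eq_big => [x|x _]; last by rewrite /E rkO.
have imageE : (val x \in lower_poset_image (boundary (Gamma_poset P s))) =
              (Some x \in boundary (Gamma_poset P s)).
  apply/imsetP/idP => [[y]|xb]; last by exists x => //; rewrite in_set.
  by rewrite in_set => yb /val_inj ->.
have : val x \in P s :\ s :|: lower_poset_image (boundary (Gamma_poset P s)).
  by rewrite -Gamma_union; apply: valP.
rewrite -imageE in_setU; have [xP _|_ /= ->//] := boolP (val x \in P s :\ s).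
by rewrite (disjointFr Gamma_disj).
Qed.

End Partition.

End Decomposition.

(** * The recursion and the signs *)

Section CdIndex.
Context {disp : Order.disp_t}.
Implicit Types (Omega Gamma : finTPOrderType disp).

Lemma eulerian_bottom Omega : eulerian Omega -> has_bottom Omega.
Proof. by case=> -[]. Qed.

Lemma flag_sum_top_sym (R : nzRingType) (a b : R) Omega :
  eulerian Omega -> (0 < poset_rank Omega)%N ->
  flag_sum a b (\top%O : Omega) = flag_sum b a (\top%O : Omega).
Proof. by move=> eul rk; apply: flag_sum_sym. Qed.

Lemma S_partition_eulerian Omega P (s1 st : Omega) : S_partition P s1 st ->
  [/\ eulerian Omega, (2 <= poset_rank Omega)%N & s1 \in coatoms Omega].
Proof. by case=> {}P {}s1 {}st ? ? _ [[? _] _] *. Qed.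

Lemma S_partitionable_eulerian Omega : S_partitionable Omega ->
  eulerian Omega /\ (0 < poset_rank Omega)%N.
Proof.
case=> [eul ->|P s1 st /S_partition_eulerian[eul rk2 _]]; first by split.
by split=> //; apply: ltnW.
Qed.

Lemma S_partition_initial Omega P (s1 st : Omega) : S_partition P s1 st ->
  S_partitionable (coatom_boundary s1) /\
  (poset_rank (coatom_boundary s1)).+1 = poset_rank Omega.
Proof. by case. Qed.

Lemma S_partition_ordinary Omega P (s1 st : Omega) : S_partition P s1 st ->
  forall s, s \in ordinary s1 st ->
  (poset_rank (Gamma_suspension P s)).+1 = poset_rank Omega /\
  exists Q t, @S_partition disp (Gamma_suspension P s) Q
                (added_coatom (Gamma_poset P s)) t.
Proof. by case. Qed.

(** The boundary of Gamma is what lies below the added coatom, so it inherits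
S-partitionability from the initial coatom of the semisuspension. *)
Lemma ab_index_Gamma_boundary Gamma :
  ab_index (coatom_boundary (added_coatom Gamma)) =
  ab_index (boundary_poset Gamma).
Proof.
by rewrite !ab_indexE flag_sum_coatom_boundary flag_sum_added_coatom.
Qed.

(** The right-hand side is [U (a + b) + V (ab + ba)] with [U + V b] equal to
[lower_flag_sum Omega a b]; both [U] and [V] are symmetric, as the parts are
Eulerian, so [lower_flag_sum Omega b a] is [U + V a]. *)
Lemma S_partition_flag_sum (R : nzRingType) (a b : R) Omega P (s1 st : Omega) :
    S_partition P s1 st ->
    (forall X : R, X * (a - b) = 0 -> X = 0) ->
  flag_sum a b (\top%O : Omega) =
    (flag_sum a b (\top%O : coatom_boundary s1) +
     \sum_(s in ordinary s1 st)
       (flag_sum a b (\top%O : Gamma_suspension P s)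
        - flag_sum a b (\top%O : Gamma_boundary P s) * (a + b))) * (a + b) +
    (\sum_(s in ordinary s1 st)
       flag_sum a b (\top%O : Gamma_boundary P s)) * (a * b + b * a).
Proof.
move=> hP cancel; have [eul rk2 s1_co] := S_partition_eulerian hP.
have bot := eulerian_bottom eul.
have topE x y := flag_sum_top (R := R) x y bot rk2.
have co_sym : \sum_(s in coatoms Omega) flag_sum b a s =
              \sum_(s in coatoms Omega) flag_sum a b s.
  apply: eq_bigr => s; rewrite inE => /eqP rs; apply: flag_sum_sym => //.
  by rewrite -ltnS rs.
rewrite topE; apply: (@cd_regroup_top _ _ (lower_flag_sum Omega b a)).
- apply/cancel/regroup_cancel; rewrite -topE -co_sym -topE.
  by apply: flag_sum_top_sym => //; apply: ltnW.
- rewrite (lower_flag_sum_partition _ _ hP) -addrA; congr (_ + _).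
  rewrite mulr_suml -big_split; apply: eq_bigr => s _ /=.
  by rewrite mulrDr opprD addrA subrK.
rewrite (lower_flag_sum_partition _ _ hP) -addrA; congr (_ + _).
  have [/S_partitionable_eulerian[]] := S_partition_initial hP.
  by move=> *; apply: flag_sum_top_sym.
rewrite mulr_suml -big_split; apply: eq_bigr => s s_ord /=.
have [_ [Q [t hQ]]] := S_partition_ordinary hP s_ord.
have [eulS rkS _] := S_partition_eulerian hQ.
have [/S_partitionable_eulerian[eulB rkB] _] := S_partition_initial hQ.
have -> : flag_sum b a (\top%O : Gamma_boundary P s) =
          flag_sum a b (\top%O : Gamma_boundary P s).
  have bE x y := etrans (flag_sum_coatom_boundary (added_coatom _) x y)
                        (flag_sum_added_coatom (Gamma_poset P s) x y).
  by rewrite -2!bE; apply: flag_sum_top_sym.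
rewrite (flag_sum_top_sym b a eulS) ?(ltnW rkS) //.
by rewrite mulrDr [_ * a + _]addrC opprD addrA subrK.
Qed.

Lemma rmorph_recursion (R S : nzRingType) (f : {rmorphism R -> S}) (I : finType)
    (A : {set I}) (F : R) (G H : I -> R) (F' : S) (G' H' : I -> S) c d c' d' :
    f F = F' ->
    {in A, forall i, f (G i) = G' i} -> {in A, forall i, f (H i) = H' i} ->
    f c = c' -> f d = d' ->
  f (F * c + \sum_(i in A) ((G i - H i * c) * c + H i * d)) =
  (F' + \sum_(i in A) (G' i - H' i * c')) * c' + (\sum_(i in A) H' i) * d'.
Proof.
move=> <- fG fH <- <-; rewrite mulrDl !mulr_suml -addrA -big_split /=.
rewrite rmorphD rmorphM rmorph_sum; congr (_ + _); apply: eq_bigr => i Ai.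
by rewrite rmorphD !rmorphM rmorphB rmorphM fG ?fH.
Qed.

Lemma S_partition_cd_index Omega P (s1 st : Omega) F (G H : Omega -> ncpoly) :
    S_partition P s1 st ->
    is_cd_index (coatom_boundary s1) F ->
    {in ordinary s1 st, forall s, is_cd_index (Gamma_suspension P s) (G s)} ->
    {in ordinary s1 st, forall s, is_cd_index (Gamma_boundary P s) (H s)} ->
  is_cd_index Omega (F * var_c
    + \sum_(s in ordinary s1 st) ((G s - H s * var_c) * var_c + H s * var_d)).
Proof.
rewrite /is_cd_index => hP hF hG hH; rewrite ab_indexE.
rewrite (S_partition_flag_sum hP mul_sub_ab_eq0).
apply: rmorph_recursion cd_subst_c cd_subst_d.
- exact: etrans hF (ab_indexE _).
- by move=> s s_ord; apply: etrans (hG s s_ord) (ab_indexE _).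
by move=> s s_ord; apply: etrans (hH s s_ord) (ab_indexE _).
Qed.

Lemma cd_indexP Omega F : is_cd_index Omega F -> cd_index Omega = F.
Proof.
move=> hF; apply: cd_subst_inj.
rewrite [RHS]hF.
by apply: (epsilon_spec (inhabits 0) (is_cd_index Omega)); exists F.
Qed.

Lemma cd_index_eq Omega Gamma :
  ab_index Omega = ab_index Gamma -> cd_index Omega = cd_index Gamma.
Proof. by rewrite /cd_index /is_cd_index => ->. Qed.

Lemma is_cd_index_boundary Gamma :
  is_cd_index (coatom_boundary (added_coatom Gamma))
    (cd_index (coatom_boundary (added_coatom Gamma))) ->
  is_cd_index (boundary_poset Gamma) (cd_index (boundary_poset Gamma)).
Proof.
by rewrite /is_cd_index (cd_index_eq (ab_index_Gamma_boundary Gamma))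
  ab_index_Gamma_boundary.
Qed.

Lemma is_cd_index1 Omega :
  eulerian Omega -> poset_rank Omega = 1%N -> is_cd_index Omega 1.
Proof.
move=> /eulerian_bottom bot rk1; rewrite /is_cd_index ab_indexE.
case: (bot) => z zmin; rewrite flag_sum_rec -/(poset_rank Omega) ?rk1 //.
rewrite (big_pred1 z) => [|y].
  by rewrite /flag_term (rank_bottom zmin) /= mul1r; apply: rmorph1.
by rewrite lt_top_rank rk1 ltnS leqn0 (rank_eq0 zmin).
Qed.

(** The existence of the cd-index comes from the recursion itself: the cd-indices
of the parts, which have smaller rank, give that of the whole poset. *)
Lemma cd_index_spec n Omega :
  (poset_rank Omega < n)%N -> S_partitionable Omega ->
  is_cd_index Omega (cd_index Omega).
Proof.
elim: n Omega => // n IHn Omega rk hOmega.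
suff [F hF] : exists F, is_cd_index Omega F by rewrite (cd_indexP hF).
case: hOmega => [eul rk1|P s1 st hP]; first by exists 1; apply: is_cd_index1.
have [s1_part s1_rk] := S_partition_initial hP.
eexists; apply: (S_partition_cd_index hP).
- apply: IHn s1_part; lia.
- move=> s s_ord; have [s_rk [Q [t hQ]]] := S_partition_ordinary hP s_ord.
  apply: (IHn (Gamma_suspension P s)); last exact: S_partitionable_partition hQ.
  lia.
move=> s s_ord; have [s_rk [Q [t hQ]]] := S_partition_ordinary hP s_ord.
have [tau_part tau_rk] := S_partition_initial hQ.
apply: (@is_cd_index_boundary (Gamma_poset P s)); apply: IHn tau_part; lia.
Qed.

Lemma cd_index_recursion Omega P (s1 st : Omega) : S_partition P s1 st ->
  cd_index Omega =
    cd_index (coatom_boundary s1) * var_c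
    + \sum_(s in ordinary s1 st)
        ((cd_index (Gamma_suspension P s)
          - cd_index (Gamma_boundary P s) * var_c) * var_c
         + cd_index (Gamma_boundary P s) * var_d).
Proof.
move=> hP; apply: cd_indexP; apply: (S_partition_cd_index hP).
- by have [hp _] := S_partition_initial hP; apply: (cd_index_spec (ltnSn _)).
- move=> s s_ord; have [s_rk [Q [t hQ]]] := S_partition_ordinary hP s_ord.
  by apply: (cd_index_spec (ltnSn _)); apply: S_partitionable_partition hQ.
move=> s s_ord; have [s_rk [Q [t hQ]]] := S_partition_ordinary hP s_ord.
have [tau_part tau_rk] := S_partition_initial hQ.
by apply: is_cd_index_boundary; apply: (cd_index_spec (ltnSn _)).
Qed.

(** The second claim is what makes the induction work: applied to the
semisuspensions, whose initial coatom is the added one, it says that the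
differences in the recursion are non-negative. *)
Lemma cd_index_nonneg n Omega : (poset_rank Omega < n)%N ->
  (S_partitionable Omega -> nc_nonneg (cd_index Omega)) /\
  (forall P (s1 st : Omega), S_partition P s1 st ->
     nc_nonneg (cd_index Omega - cd_index (coatom_boundary s1) * var_c)).
Proof.
elim: n Omega => // n IHn Omega rk.
have part_nonneg P (s1 st : Omega) : S_partition P s1 st ->
     nc_nonneg (cd_index Omega - cd_index (coatom_boundary s1) * var_c).
  move=> hP; rewrite (cd_index_recursion hP) addrC addKr.
  apply: (big_ind nc_nonneg nc_nonneg0 nc_nonnegD) => s s_ord.
  have [s_rk [Q [t hQ]]] := S_partition_ordinary hP s_ord.
  have [tau_part tau_rk] := S_partition_initial hQ.
  have bE := cd_index_eq (ab_index_Gamma_boundary (Gamma_poset P s)).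
  rewrite -bE; apply: nc_nonnegD; apply: nc_nonneg_mul_var.
    by have [|_ h] := IHn (Gamma_suspension P s); [lia | apply: h hQ].
  have [|h _] := IHn (@coatom_boundary disp (Gamma_suspension P s)
    (added_coatom (Gamma_poset P s))); first by lia.
  exact: h.
split=> // -[eul rk1|P s1 st hP].
  rewrite (cd_indexP (is_cd_index1 eul rk1)); exact: nc_nonneg1.
rewrite -(subrK (cd_index (coatom_boundary s1) * var_c) (cd_index Omega)).
apply: nc_nonnegD; first exact: part_nonneg hP.
apply: nc_nonneg_mul_var; have [s1_part s1_rk] := S_partition_initial hP.
by have [|h _] := IHn (coatom_boundary s1); [lia | apply: h].
Qed.

End CdIndex.

Theorem theoremA (disp : Order.disp_t) (Omega : finTPOrderType disp)
  (hOmega : S_partitionable Omega) :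
  [/\ (* base of the recursion *)
      poset_rank Omega = 1%N -> cd_index Omega = 1,
      (* recursion, for every S-partition of Omega *)
      forall (P : Omega -> {set Omega}) (s1 st : Omega),
        S_partition P s1 st ->
        cd_index Omega =
          cd_index (coatom_boundary s1) * var_c
          + \sum_(s in ordinary s1 st)
              ((cd_index (Gamma_suspension P s)
                - cd_index (Gamma_boundary P s) * var_c) * var_c
               + cd_index (Gamma_boundary P s) * var_d)
    & (* non-negativity of all the coefficients *)
      forall w : {fmonom bool}, 0 <= (cd_index Omega)@_w].
Proof.
split.
- move=> rk1; have [eul _] := S_partitionable_eulerian hOmega.
  exact/cd_indexP/is_cd_index1.
- by move=> P s1 st; apply: cd_index_recursion.
by have [h _] := cd_index_nonneg (ltnSn (poset_rank Omega)); apply: h.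
Qed.
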